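(* The only pairs $(n,x)$ of positive integers with $n\geq 2$ satisfying $(2^{n}-2)(10^{n}-2)=x^{2}$ are $(n,x)=(2,14)$ and $(n,x)=(6,7874)$. *)

(* Defs.v *)
From Stdlib Require Export ZArith.

(* Main.v *)
(** With [m = n - 1] and [x = 2 y], the equation reads [(2^m - 1) (5 10^m - 1) = y^2], so
    both factors are [D] times a square, [D] being their gcd.

    For [m = 2 j] with [j = 2^e r], [r] odd, the factor [4^r - 1] of [4^j - 1] is coprime
    to its cofactor and is 3 modulo 5; but it is a square times a divisor of
    [5 10^m - 1], and odd divisors of [z^2 - 5] are 0, 1 or 4 modulo 5.

    For [m = 2 k + 1], both [2^k] and [5 10^k] are [X]-parts of solutions of
    [2 X^2 - D Y^2 = 1], all of which are odd powers of the least one. Since [X] is an odd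
    multiple of the least [X1], [2^k] is [X1], and the quotient [5^(k+1)] is the value at
    [a = 2^m] of a polynomial that is divisible by 5 only if [4 a - 3] divides it.
    Hence [2^(m+2) - 3] is a power of 5, which leaves [m = 1] and [m = 5]. *)

Require Import Defs.
From Stdlib Require Import ZArith Znumtheory Zpow_facts Classical_Prop List Lia.
Open Scope Z_scope.

(** * Products that are squares *)

(** After cancelling [g = gcd a c], the cofactor [a'] of [a] divides [g]. The quotient of [g] by
    [a'] divides both [a] and [b], so it is a unit, and [0 < a] fixes its sign. *)
Lemma coprime_mul_square (a b c : Z) :
  0 < a -> rel_prime a b -> a * b = c ^ 2 -> exists u, a = u ^ 2.
Proof.
  intros ha hab h.
  pose proof (Z.gcd_nonneg a c) as hg0.
  assert (hg : Z.gcd a c <> 0) by (intros e; apply Z.gcd_eq_0_l in e; lia).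
  pose proof (Z.gcd_div_gcd a c _ hg eq_refl) as hcop.
  destruct (Z.gcd_divide_l a c) as [a' ea].
  destruct (Z.gcd_divide_r a c) as [c' ec].
  set (g := Z.gcd a c) in *.
  rewrite ea, ec, !Z.div_mul in hcop by assumption.
  assert (e : a' * b = g * c' ^ 2).
  { apply (Z.mul_cancel_l _ _ g hg). rewrite ea, ec in h. lia. }
  assert (hd : (a' | g)).
  { apply Gauss with (c' ^ 2).
    - exists b. lia.
    - apply rel_prime_Zpower_r; [lia|]. now apply Zgcd_1_rel_prime. }
  destruct hd as [h' eg].
  assert (ha' : a' <> 0) by (intros ->; lia).
  assert (eb : b = h' * c' ^ 2).
  { apply (Z.mul_cancel_l _ _ a' ha'). rewrite e, eg. ring. }
  assert (h1 : (h' | 1)).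
  { apply hab.
    - exists (a' * a'). rewrite ea, eg. ring.
    - exists (c' ^ 2). rewrite eb. ring. }
  apply Z.divide_1_r in h1.
  exists a'. destruct h1 as [-> | ->]; rewrite ea, eg; nia.
Qed.

Lemma square_divide (a b : Z) : a <> 0 -> (a ^ 2 | b ^ 2) -> (a | b).
Proof.
  intros ha [k h].
  assert (hd : Z.gcd a b <> 0) by (intros e; apply Z.gcd_eq_0_l in e; lia).
  pose proof (Z.gcd_div_gcd a b _ hd eq_refl) as hcop.
  destruct (Z.gcd_divide_l a b) as [a' ea].
  destruct (Z.gcd_divide_r a b) as [b' eb].
  set (d := Z.gcd a b) in *.
  rewrite ea, eb, !Z.div_mul in hcop by assumption.
  apply Zgcd_1_rel_prime in hcop.
  assert (e : b' ^ 2 = k * a' ^ 2).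
  { apply (Z.mul_cancel_l _ _ (d * d)); [nia|]. rewrite ea, eb in h. lia. }
  assert (h1 : (a' | b' ^ 2)) by (exists (k * a'); rewrite e; ring).
  assert (h2 : (a' | 1)).
  { apply (rel_prime_Zpower_r 2 _ _ ltac:(lia) hcop); [apply Z.divide_refl|assumption]. }
  apply Z.divide_1_r in h2.
  exists (b' * a'). rewrite eb, ea. destruct h2 as [-> | ->]; ring.
Qed.

(** The gcd divides [c] by [square_divide]; cancelling it leaves coprime cofactors whose product is
    still a square. *)
Lemma mul_square_gcd (a b c : Z) :
  0 < a -> 0 < b -> a * b = c ^ 2 ->
  exists u v, a = Z.gcd a b * u ^ 2 /\ b = Z.gcd a b * v ^ 2.
Proof.
  intros ha hb h.
  pose proof (Z.gcd_nonneg a b) as hg0.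
  assert (hg : Z.gcd a b <> 0) by (intros e; apply Z.gcd_eq_0_l in e; lia).
  pose proof (Z.gcd_div_gcd a b _ hg eq_refl) as hcop.
  destruct (Z.gcd_divide_l a b) as [a' ea].
  destruct (Z.gcd_divide_r a b) as [b' eb].
  set (g := Z.gcd a b) in *.
  rewrite ea, eb, !Z.div_mul in hcop by assumption.
  apply Zgcd_1_rel_prime in hcop.
  assert (hgc : (g | c)).
  { apply square_divide; [assumption|].
    exists (a' * b'). rewrite <- h, ea, eb. ring. }
  destruct hgc as [c' ec].
  assert (e : a' * b' = c' ^ 2).
  { apply (Z.mul_cancel_l _ _ (g * g)); [nia|]. rewrite ea, eb, ec in h. lia. }
  destruct (coprime_mul_square a' b' c') as [u eu]; [nia|assumption|assumption|].
  destruct (coprime_mul_square b' a' c') as [v ev];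
    [nia|now apply rel_prime_sym|lia|].
  exists u, v. split; [rewrite ea, eu|rewrite eb, ev]; ring.
Qed.

(** * Residues modulo 5 of squares and of divisors of [z ^ 2 - 5] *)

Lemma prime_5 : prime 5.
Proof.
  apply prime_alt. split; [lia|]. intros n hn [k hk].
  assert (e : n = 2 \/ n = 3 \/ n = 4) by lia.
  destruct e as [-> | [-> | ->]]; lia.
Qed.

(** 1 and 4 form a subgroup of the units modulo 5, and [c] being a unit excludes [k mod 5 = 0]. *)
Lemma mod5_quotient (n k c : Z) :
  n * k mod 5 = c -> c = 1 \/ c = 4 ->
  k mod 5 = 0 \/ k mod 5 = 1 \/ k mod 5 = 4 -> n mod 5 = 1 \/ n mod 5 = 4.
Proof.
  intros h hc hk. rewrite Z.mul_mod in h by lia.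
  pose proof (Z.mod_pos_bound n 5 ltac:(lia)) as hn.
  assert (e : n mod 5 = 0 \/ n mod 5 = 1 \/ n mod 5 = 2 \/ n mod 5 = 3 \/ n mod 5 = 4)
    by lia.
  destruct hk as [hk | [hk | hk]];
    destruct e as [e | [e | [e | [e | e]]]]; rewrite e, hk in h; rewrite e; cbn in h; lia.
Qed.

Lemma square_mod5 (x : Z) : x ^ 2 mod 5 = 0 \/ x ^ 2 mod 5 = 1 \/ x ^ 2 mod 5 = 4.
Proof.
  rewrite Zpower_mod by lia.
  pose proof (Z.mod_pos_bound x 5 ltac:(lia)) as hx.
  assert (e : x mod 5 = 0 \/ x mod 5 = 1 \/ x mod 5 = 2 \/ x mod 5 = 3 \/ x mod 5 = 4)
    by lia.
  destruct e as [-> | [-> | [-> | [-> | ->]]]]; cbn; lia.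
Qed.

(* An even [y] in [0, n) with [n | y^2 - 5] has an odd cofactor smaller than [n],
   which replaces quadratic reciprocity by a descent. *)
Lemma odd_divisor_sq_sub_5 (n x : Z) :
  0 < n -> Z.Odd n -> (n | x ^ 2 - 5) -> n mod 5 = 0 \/ n mod 5 = 1 \/ n mod 5 = 4.
Proof.
  intros hn. assert (hn0 : 0 <= n) by lia. revert x hn.
  pattern n; apply Zlt_0_ind; [|assumption]. clear n hn0.
  intros n IH _ x hn hodd hx.
  assert (hy : exists y, 0 <= y < n /\ Z.Even y /\ (n | y ^ 2 - 5)).
  { pose proof (Z.mod_pos_bound x n hn) as hr.
    pose proof (Z.div_mod x n ltac:(lia)) as ex.
    destruct hx as [k hk].
    destruct (Z.Even_or_Odd (x mod n)) as [he | ho].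
    - exists (x mod n). split; [lia|split; [assumption|]].
      exists (k - (x / n) * (x + x mod n)). nia.
    - exists (n - x mod n). split; [destruct ho; lia|split].
      + destruct ho as [i hi], hodd as [j hj]. exists (j - i). lia.
      + exists (k + (1 + x / n) * (n - x mod n - x)). nia. }
  destruct hy as (y & hy & [z ez] & k & hk).
  assert (hc : z = 0 \/ z = 1 \/ 2 <= z) by lia.
  destruct hc as [-> | [-> | hz]].
  - assert (h5 : (n | 5)) by (exists (- k); lia).
    apply prime_divisors in h5; [|exact prime_5].
    destruct h5 as [h | [h | [h | h]]]; try lia; subst n; cbn; lia.
  - assert (h1 : (n | 1)) by (exists (- k); lia).
    apply Z.divide_1_r in h1. destruct h1 as [-> | ->]; cbn; lia.
  - assert (hk0 : 0 < k < n) by nia.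
    assert (hko : Z.Odd k).
    { destruct (Z.Even_or_Odd k) as [[i hi] | h]; [exfalso|assumption]. nia. }
    destruct (Z.eq_dec (y mod 5) 0) as [h0 | h0].
    + pose proof (Z.div_mod y 5 ltac:(lia)) as ey. rewrite h0 in ey.
      assert (hp : (5 | n * k)) by (exists (y * (y / 5) - 1); nia).
      apply prime_mult in hp; [|exact prime_5].
      destruct hp as [[i hi] | [i hi]]; [left; rewrite hi; apply Z.mod_mul; lia|right].
      (* Here [n * i = 5 * (y / 5) ^ 2 - 1] is 4 modulo 5, so the descent passes to [i] instead of
         [k = 5 * i]. *)
      assert (hi5 : i mod 5 = 0 \/ i mod 5 = 1 \/ i mod 5 = 4).
      { apply (IH i) with y; [lia|lia| |exists (n * 5); nia].
        destruct (Z.Even_or_Odd i) as [[j hj] | h]; [exfalso|assumption].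
        destruct hko. lia. }
      apply (mod5_quotient n i 4); [|lia|assumption].
      replace (n * i) with (4 + ((y / 5) * (y / 5) - 1) * 5) by nia.
      rewrite Z.mod_add by lia. reflexivity.
    + right.
      apply (mod5_quotient n k (y ^ 2 mod 5)).
      * replace (n * k) with (y ^ 2 + (-1) * 5) by lia. apply Z.mod_add. lia.
      * destruct (square_mod5 y) as [h | h]; [exfalso|assumption].
        apply h0, Z.mod_divide; [lia|].
        apply Z.mod_divide in h; [|lia].
        rewrite Z.pow_2_r in h. apply prime_mult in h; [tauto|exact prime_5].
      * apply (IH k) with y; [lia|lia|assumption|exists n; lia].
Qed.

(** * The case of even [n - 1] *)

(** For odd [j], [4 ^ j] is -1 modulo 5 and [c = 1] works. For [j = 2 * i], the new factor
    [4 ^ i + 1] is odd and exceeds [4 ^ i - 1] by 2, so it is coprime to the divisor [a] of the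
    latter. *)
Lemma pow4_sub_1_split (j : Z) :
  0 < j -> exists a c, 4 ^ j - 1 = a * c /\ 0 < a /\ a mod 5 = 3 /\ rel_prime a c.
Proof.
  intros hj. assert (hj0 : 0 <= j) by lia. revert hj.
  pattern j; apply Zlt_0_ind; [|assumption]. clear j hj0.
  intros j IH _ hj.
  destruct (Z.Even_or_Odd j) as [[i ei] | [i ei]].
  - destruct (IH i) as (a & c & e & ha & ha5 & hac); [lia|lia|].
    exists a, (c * (4 ^ i + 1)). split; [|split; [assumption|split; [assumption|]]].
    + rewrite ei, Z.mul_comm, Z.pow_mul_r by lia. rewrite Z.pow_2_r. nia.
    + apply rel_prime_mult; [assumption|].
      assert (e4 : 4 ^ i = 2 * (2 * 4 ^ (i - 1))).
      { replace i with (Z.succ (i - 1)) at 1 by lia. rewrite Z.pow_succ_r by lia. ring. }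
      (* With [h = 4 ^ i / 2], this is [h * (4 ^ i - 1) + (1 - h) * (4 ^ i + 1) = 1]. *)
      apply bezout_rel_prime, Bezout_intro with (c * (2 * 4 ^ (i - 1)))  (1 - 2 * 4 ^ (i - 1)).
      nia.
  - assert (hm : (4 ^ j - 1) mod 5 = 3).
    { rewrite ei, Z.pow_add_r, Z.pow_mul_r by lia.
      rewrite Zminus_mod, Z.mul_mod, (Zpower_mod (4 ^ 2)) by lia.
      change (4 ^ 2 mod 5) with 1. rewrite Z.pow_1_l by lia. reflexivity. }
    exists (4 ^ j - 1), 1. split; [lia|split; [|split; [exact hm|]]].
    + assert (4 ^ 1 <= 4 ^ j) by (apply Z.pow_le_mono_r; lia). lia.
    + apply rel_prime_sym, rel_prime_1.
Qed.

Lemma no_even_solution (j y : Z) :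
  0 < j -> (4 ^ j - 1) * (5 * 10 ^ (2 * j) - 1) <> y ^ 2.
Proof.
  intros hj h.
  destruct (pow4_sub_1_split j hj) as (a & c & e & ha & ha5 & hac).
  assert (h4 : 4 ^ 1 <= 4 ^ j) by (apply Z.pow_le_mono_r; lia).
  assert (eb : 5 * 10 ^ (2 * j) - 1 = 5 * (10 ^ j) ^ 2 - 1).
  { rewrite Z.mul_comm, (Z.mul_comm 2), Z.pow_mul_r by lia. ring. }
  set (b := 5 * 10 ^ (2 * j) - 1) in *.
  assert (hb : 0 < b).
  { unfold b. pose proof (Z.pow_pos_nonneg 10 (2 * j) ltac:(lia) ltac:(lia)). lia. }
  rewrite e in h.
  destruct (mul_square_gcd a (c * b) y) as (u & _ & eu & _); [assumption|nia|lia|].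
  pose proof (Z.gcd_nonneg a (c * b)) as hg0.
  destruct (Z.gcd_divide_r a (c * b)) as [l el].
  destruct (Z.gcd_divide_l a (c * b)) as [l' el'].
  set (g := Z.gcd a (c * b)) in *.
  assert (hgb : (g | b)).
  { apply Gauss with c; [now exists l|].
    apply rel_prime_div with a; [assumption|now exists l']. }
  destruct hgb as [q eq].
  assert (hodd : Z.Odd g).
  { destruct (Z.Even_or_Odd g) as [[i hi] | ho]; [exfalso|assumption].
    assert (e10 : 10 ^ j = 10 * 10 ^ (j - 1)).
    { replace j with (Z.succ (j - 1)) at 1 by lia. apply Z.pow_succ_r. lia. }
    rewrite hi, eb, e10 in eq. nia. }
  (* Since [5 * b = (5 * 10 ^ j) ^ 2 - 5], [g] is 0, 1 or 4 modulo 5, and then [g * u ^ 2] cannot be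
     3. *)
  destruct (odd_divisor_sq_sub_5 g (5 * 10 ^ j)) as [h5 | h5]; [nia|assumption| | |].
  - exists (5 * q). nia.
  - rewrite eu, Z.mul_mod, h5 in ha5 by lia. cbn in ha5. discriminate.
  - rewrite eu, Z.mul_mod in ha5 by lia.
    destruct (square_mod5 u) as [hu | [hu | hu]]; rewrite hu in ha5;
      destruct h5 as [h5 | h5]; rewrite h5 in ha5; discriminate ha5.
Qed.

(** * Solutions of [2 * X ^ 2 = D * Y ^ 2 + 1] *)

(* [pell_orbit a p q]: if [a = 2 X^2] and [a - 1 = D Y^2], then [(X p, Y q)] is obtained
   from [(X, Y)] through multiplying [X sqrt 2 + Y sqrt D] by an even power of itself. *)
Inductive pell_orbit (a : Z) : Z -> Z -> Prop :=
| pell_orbit_base : pell_orbit a 1 1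
| pell_orbit_step (p q : Z) : pell_orbit a p q ->
    pell_orbit a (p * (2 * a - 1) + 2 * (a - 1) * q) (q * (2 * a - 1) + 2 * a * p).

Lemma pell_orbit_odd (a p q : Z) : pell_orbit a p q -> Z.Odd p.
Proof.
  induction 1 as [|p q _ [i hi]]; [now exists 0|].
  exists (i * (2 * a - 1) + (a - 1) + (a - 1) * q). lia.
Qed.

(** For such [a] the orbit step is [(p, q) -> (-q, p)] modulo 5, so both coordinates remain 1 or
    -1. *)
Lemma pell_orbit_three_mod5 (a p q : Z) :
  a mod 5 = 3 -> pell_orbit a p q -> ~ (5 | p).
Proof.
  intros ha h.
  assert (hinv : exists i j, (p = 5 * i + 1 \/ p = 5 * i - 1) /\
                             (q = 5 * j + 1 \/ q = 5 * j - 1)).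
  { pose proof (Z.div_mod a 5 ltac:(lia)) as ea. rewrite ha in ea.
    set (b := a / 5) in ea. rewrite ea in h.
    induction h as [|p q _ (i & j & hp & hq)]; [exists 0, 0; lia|].
    exists ((2 * b + 1) * (p + q) - j), ((2 * b + 1) * (p + q) + i). lia. }
  destruct hinv as (i & j & hp & _). intros [k hk]. lia.
Qed.

(* Modulo [4 a - 3] the orbit is periodic: up to sign, [(1, 1)], [(0, 2)], [(-1, 1)]. *)
Lemma pell_orbit_rank_three (a p q : Z) :
  (5 | 4 * a - 3) -> pell_orbit a p q -> (5 | p) -> (4 * a - 3 | p).
Proof.
  intros [c hc] h [d hd].
  assert (hinv : exists i j e, (e = 1 \/ e = -1) /\
    (p = (4 * a - 3) * i + e /\ q = (4 * a - 3) * j + e \/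
     p = (4 * a - 3) * i /\ q = (4 * a - 3) * j + 2 * e \/
     p = (4 * a - 3) * i - e /\ q = (4 * a - 3) * j + e)).
  { clear d hd.
    induction h as [|p q _ (i & j & e & he & H)]; [exists 0, 0, 1; lia|].
    (* By linearity the quotients [(i, j)] undergo the orbit step too; each added [e] is the carry
       from stepping the residues. *)
    set (i' := i * (2 * a - 1) + 2 * (a - 1) * j).
    set (j' := j * (2 * a - 1) + 2 * a * i).
    destruct H as [[-> ->] | [[-> ->] | [-> ->]]].
    - exists (i' + e), (j' + e), e. split; [assumption|right; left]. unfold i', j'. lia.
    - exists (i' + e), (j' + e), e. split; [assumption|right; right]. unfold i', j'. lia.
    - exists i', j', (- e). split; [lia|left]. unfold i', j'. lia. }
  (* In the first and third classes [p] would be 1 or -1 modulo 5. *)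
  destruct hinv as (i & j & e & he & [[hp _] | [[hp _] | [hp _]]]).
  - rewrite hc in hp. lia.
  - exists i. lia.
  - rewrite hc in hp. lia.
Qed.

(** Multiplying [X sqrt 2 + Y sqrt D] by the conjugate [X1 sqrt 2 - Y1 sqrt D] gives
    [s + w sqrt (2 D)], of norm 1; multiplying by it again gives [X' sqrt 2 + Y' sqrt D]. *)
Lemma pell_descent (D X1 Y1 X Y : Z) :
  0 < D -> 0 < X1 -> 0 < Y1 -> 0 < X -> 0 < Y ->
  2 * X1 ^ 2 = D * Y1 ^ 2 + 1 -> 2 * X ^ 2 = D * Y ^ 2 + 1 -> X1 < X ->
  (forall X' Y', 0 < X' -> 0 < Y' -> 2 * X' ^ 2 = D * Y' ^ 2 + 1 -> X1 <= X') ->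
  exists X' Y', 0 < X' < X /\ 0 < Y' /\ 2 * X' ^ 2 = D * Y' ^ 2 + 1 /\
    X = X' * (4 * X1 ^ 2 - 1) + 2 * X1 * Y1 * D * Y' /\
    Y = Y' * (4 * X1 ^ 2 - 1) + 4 * X1 * Y1 * X'.
Proof.
  intros hD hX1 hY1 hX hY h1 h hlt hmin.
  set (s := 2 * X * X1 - D * Y * Y1).
  set (w := X1 * Y - X * Y1).
  assert (hs : 0 < s).
  { enough (D * Y * Y1 < 2 * X * X1) by (unfold s; lia).
    apply Z.square_lt_simpl_nonneg; [nia|].
    replace (D * Y * Y1 * (D * Y * Y1)) with ((D * Y ^ 2) * (D * Y1 ^ 2)) by ring.
    replace (2 * X * X1 * (2 * X * X1)) with ((2 * X ^ 2) * (2 * X1 ^ 2)) by ring.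
    rewrite h, h1. nia. }
  assert (hw : 0 < w).
  { enough (X * Y1 < X1 * Y) by (unfold w; lia).
    apply Z.square_lt_simpl_nonneg; [nia|].
    apply (Z.mul_lt_mono_pos_l D); [assumption|].
    replace (D * (X * Y1 * (X * Y1))) with (X ^ 2 * (D * Y1 ^ 2)) by ring.
    replace (D * (X1 * Y * (X1 * Y))) with (X1 ^ 2 * (D * Y ^ 2)) by ring.
    replace (D * Y1 ^ 2) with (2 * X1 ^ 2 - 1) by lia.
    replace (D * Y ^ 2) with (2 * X ^ 2 - 1) by lia. nia. }
  assert (hsw : s ^ 2 = 2 * D * w ^ 2 + 1).
  { replace 1 with ((2 * X ^ 2 - D * Y ^ 2) * (2 * X1 ^ 2 - D * Y1 ^ 2))
      by (rewrite h, h1; ring).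
    unfold s, w. ring. }
  assert (eX : X = s * X1 + w * D * Y1).
  { replace X with (X * (2 * X1 ^ 2 - D * Y1 ^ 2)) at 1 by (rewrite h1; ring).
    unfold s, w. ring. }
  assert (eY : Y = s * Y1 + 2 * w * X1).
  { replace Y with (Y * (2 * X1 ^ 2 - D * Y1 ^ 2)) at 1 by (rewrite h1; ring).
    unfold s, w. ring. }
  clearbody s w.
  set (X' := s * X1 - w * D * Y1).
  set (Y' := 2 * w * X1 - s * Y1).
  assert (hwd : 0 < w * D * Y1) by (repeat apply Z.mul_pos_pos; assumption).
  assert (hX' : 0 < X').
  { enough (w * D * Y1 < s * X1) by (unfold X'; lia).
    apply Z.square_lt_simpl_nonneg; [nia|].
    apply (Z.mul_lt_mono_pos_l 2); [lia|].
    replace (2 * (w * D * Y1 * (w * D * Y1))) with ((2 * D * w ^ 2) * (D * Y1 ^ 2)) by ring.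
    replace (2 * (s * X1 * (s * X1))) with (s ^ 2 * (2 * X1 ^ 2)) by ring.
    rewrite hsw, h1.
    assert (0 <= 2 * D * w ^ 2) by nia. assert (0 <= D * Y1 ^ 2) by nia. nia. }
  assert (hN : 2 * X' ^ 2 = D * Y' ^ 2 + 1).
  { replace 1 with ((s ^ 2 - 2 * D * w ^ 2) * (2 * X1 ^ 2 - D * Y1 ^ 2))
      by (rewrite hsw, h1; ring).
    unfold X', Y'. ring. }
  assert (hY' : 0 < Y').
  { destruct (Z.lt_ge_cases 0 Y') as [h0 | h0]; [assumption|exfalso].
    (* If [Y' <= 0], this yields [X1 >= 2 * X'], whereas minimality applied to [(X', - Y')] yields
       [X1 <= X']. *)
    assert (e : X1 = s * X' - w * D * Y').
    { replace X1 with (X1 * (s ^ 2 - 2 * D * w ^ 2)) at 1 by (rewrite hsw; ring).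
      unfold X', Y'. ring. }
    assert (h2s : 2 <= s).
    { assert (0 < D * w ^ 2)
        by (apply Z.mul_pos_pos; [assumption|apply Z.pow_pos_nonneg; lia]).
      destruct (Z.eq_dec s 1) as [es | hne]; [rewrite es in hsw|]; lia. }
    pose proof (hmin X' (- Y') hX') as hm.
    assert (hwD : 0 < w * D) by now apply Z.mul_pos_pos.
    destruct (Z.eq_dec Y' 0) as [e0 | e0].
    - rewrite e0 in hN. lia.
    - specialize (hm ltac:(lia) ltac:(lia)).
      assert (0 <= (s - 2) * X') by (apply Z.mul_nonneg_nonneg; lia).
      assert (0 <= w * D * - Y') by (apply Z.mul_nonneg_nonneg; lia).
      lia. }
  exists X', Y'. split; [|split; [|split; [|split]]]; try assumption.
  - split; [assumption|]. unfold X'. lia.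
  - replace (4 * X1 ^ 2 - 1) with (2 * X1 ^ 2 + D * Y1 ^ 2) by lia.
    rewrite eX at 1.
    replace (s * X1 + w * D * Y1)
      with ((s * X1 + w * D * Y1) * (2 * X1 ^ 2 - D * Y1 ^ 2)) by (rewrite h1; ring).
    unfold X', Y'. ring.
  - replace (4 * X1 ^ 2 - 1) with (2 * X1 ^ 2 + D * Y1 ^ 2) by lia.
    rewrite eY at 1.
    replace (s * Y1 + 2 * w * X1)
      with ((s * Y1 + 2 * w * X1) * (2 * X1 ^ 2 - D * Y1 ^ 2)) by (rewrite h1; ring).
    unfold X', Y'. ring.
Qed.

Lemma pell_minimal (D X Y : Z) :
  0 < X -> 0 < Y -> 2 * X ^ 2 = D * Y ^ 2 + 1 ->
  exists X1 Y1, 0 < X1 /\ 0 < Y1 /\ 2 * X1 ^ 2 = D * Y1 ^ 2 + 1 /\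
    forall X' Y', 0 < X' -> 0 < Y' -> 2 * X' ^ 2 = D * Y' ^ 2 + 1 -> X1 <= X'.
Proof.
  intros hX. assert (hX0 : 0 <= X) by lia. revert Y hX.
  pattern X; apply Zlt_0_ind; [|assumption]. clear X hX0.
  intros X IH _ Y hX hY h.
  destruct (classic (exists X' Y', 0 < X' < X /\ 0 < Y' /\ 2 * X' ^ 2 = D * Y' ^ 2 + 1))
    as [(X' & Y' & hX' & hY' & h') | hno].
  - apply (IH X') with Y'; lia.
  - exists X, Y. repeat split; try assumption. intros X' Y' hX' hY' h'.
    destruct (Z.le_gt_cases X X') as [hle | hgt]; [assumption|].
    exfalso. apply hno. exists X', Y'. lia.
Qed.

(** Strong induction on [X]: each descent undoes one orbit step, until [X = X1]. *)
Lemma pell_solution_orbit (D X1 Y1 X Y : Z) :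
  0 < D -> 0 < X1 -> 0 < Y1 -> 2 * X1 ^ 2 = D * Y1 ^ 2 + 1 ->
  (forall X' Y', 0 < X' -> 0 < Y' -> 2 * X' ^ 2 = D * Y' ^ 2 + 1 -> X1 <= X') ->
  0 < X -> 0 < Y -> 2 * X ^ 2 = D * Y ^ 2 + 1 ->
  exists p q, pell_orbit (2 * X1 ^ 2) p q /\ X = X1 * p /\ Y = Y1 * q.
Proof.
  intros hD hX1 hY1 h1 hmin hX. assert (hX0 : 0 <= X) by lia. revert Y hX.
  pattern X; apply Zlt_0_ind; [|assumption]. clear X hX0.
  intros X IH _ Y hX hY h.
  destruct (Z.eq_dec X X1) as [-> | hne].
  - exists 1, 1. split; [constructor|]. split; [ring|].
    assert (e : D * (Y * Y) = D * (Y1 * Y1)) by lia.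
    apply Z.mul_cancel_l in e; [nia|lia].
  - pose proof (hmin X Y hX hY h) as hle.
    destruct (pell_descent D X1 Y1 X Y) as (X' & Y' & hX' & hY' & h' & eX & eY);
      try assumption; [lia|].
    destruct (IH X') with Y' as (p & q & hpq & ep & eq); try assumption; try lia.
    exists (p * (2 * (2 * X1 ^ 2) - 1) + 2 * (2 * X1 ^ 2 - 1) * q),
           (q * (2 * (2 * X1 ^ 2) - 1) + 2 * (2 * X1 ^ 2) * p).
    split; [now constructor|]. split.
    + rewrite eX, ep, eq. replace (2 * X1 ^ 2 - 1) with (D * Y1 ^ 2) by lia. ring.
    + rewrite eY, ep, eq. ring.
Qed.

(** * The equation [2 ^ r = 5 ^ s + 3] *)

Lemma pow_mod_period (a t M s : Z) :
  0 < M -> 0 < t -> 0 <= s -> a ^ t mod M = 1 -> a ^ s mod M = a ^ (s mod t) mod M.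
Proof.
  intros hM ht hs h.
  rewrite (Z.div_mod s t) at 1 by lia.
  pose proof (Z.mod_pos_bound s t ht) as hr.
  assert (hq : 0 <= s / t) by (apply Z.div_pos; lia).
  rewrite Z.pow_add_r, Z.pow_mul_r by nia.
  rewrite Z.mul_mod, (Zpower_mod (a ^ t)), h, Z.pow_1_l by lia.
  destruct (Z.eq_dec M 1) as [-> | hM1]; [now rewrite !Z.mod_1_r|].
  rewrite (Z.mod_small 1) by lia.
  rewrite Z.mul_1_l. apply Z.mod_mod. lia.
Qed.

(** The boolean hypothesis tests every exponent below the period [t], which turns a discrete
    logarithm into a computation. *)
Lemma pow_mod_inj (a t M c r s : Z) :
  0 < M -> 0 < t -> 0 <= s -> a ^ t mod M = 1 ->
  forallb (fun i => implb (a ^ Z.of_nat i mod M =? c) (Z.of_nat i =? r))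
          (seq 0 (Z.to_nat t)) = true ->
  a ^ s mod M = c -> s mod t = r.
Proof.
  intros hM ht hs h hall hc.
  rewrite (pow_mod_period a t) in hc by assumption.
  pose proof (Z.mod_pos_bound s t ht) as hr.
  rewrite forallb_forall in hall.
  specialize (hall (Z.to_nat (s mod t))).
  rewrite Z2Nat.id in hall by lia.
  rewrite hc, Z.eqb_refl in hall.
  apply Z.eqb_eq, hall, in_seq. lia.
Qed.

(* The moduli are chosen so that the periods of 2 and 5 refine each other until
   [s = 3] modulo 256 contradicts [256 | 2 ^ r]. *)
Lemma pow2_eq_pow5_add_3 (r s : Z) : 0 <= r -> 0 <= s -> 2 ^ r = 5 ^ s + 3 -> r <= 7.
Proof.
  intros hr hs h.
  destruct (Z.le_gt_cases r 7) as [hle | hgt]; [assumption|exfalso].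
  assert (h2 : 2 ^ r = 256 * 2 ^ (r - 8)).
  { replace r with (8 + (r - 8)) at 1 by lia. apply Z.pow_add_r; lia. }
  (* All residues below are those of the solution [128 = 125 + 3], that is [r = 7], [s = 3]. *)
  assert (s32 : s mod 32 = 3).
  { apply (pow_mod_inj 5 32 128 125); [lia|lia|assumption|reflexivity|now vm_compute|].
    replace (5 ^ s) with (125 + (2 * 2 ^ (r - 8) - 1) * 128) by lia.
    apply Z.mod_add. lia. }
  assert (h5 : 5 ^ s = 25 * 5 ^ (s - 2)).
  { assert (3 <= s) by (pose proof (Z.mod_le s 32); lia).
    replace s with (2 + (s - 2)) at 1 by lia. apply Z.pow_add_r; lia. }
  assert (r20 : r mod 20 = 7).
  { apply (pow_mod_inj 2 20 25 3); [lia|lia|assumption|reflexivity|now vm_compute|].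
    rewrite h, h5, Z.add_comm, Z.mul_comm. apply Z.mod_add. lia. }
  assert (step : forall M, 0 < M -> 5 ^ s mod M = (2 ^ r mod M - 3) mod M).
  { intros M hM. rewrite Zminus_mod_idemp_l. f_equal. lia. }
  assert (s3 : s mod 3 = 0).
  { apply (pow_mod_inj 5 3 31 1); [lia|lia|assumption|reflexivity|now vm_compute|].
    rewrite step, (pow_mod_period 2 5) by easy.
    replace (r mod 5) with 2 by (Z.div_mod_to_equations; lia). reflexivity. }
  (* The residues of [s] modulo 32 and 3 combine to 3 modulo 96, a period of 5 modulo 97. *)
  assert (r48 : r mod 48 = 7).
  { apply (pow_mod_inj 2 48 97 31); [lia|lia|assumption|reflexivity|now vm_compute|].
    rewrite h, Z.add_mod, (pow_mod_period 5 96) by easy.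
    replace (s mod 96) with 3 by (Z.div_mod_to_equations; lia). reflexivity. }
  assert (s256 : s mod 256 = 3).
  { apply (pow_mod_inj 5 256 257 125); [lia|lia|assumption|reflexivity|now vm_compute|].
    rewrite step, (pow_mod_period 2 16) by easy.
    replace (r mod 16) with 7 by (Z.div_mod_to_equations; lia). reflexivity. }
  assert (e : 2 ^ r mod 256 = 128).
  { rewrite h, Z.add_mod, (pow_mod_period 5 256), s256 by easy. reflexivity. }
  rewrite h2, Z.mul_comm, Z.mod_mul in e; lia.
Qed.

(** * The case of odd [n - 1], and the conclusion *)

Lemma odd_solution (k y : Z) :
  0 <= k -> (2 ^ (2 * k + 1) - 1) * (5 * 10 ^ (2 * k + 1) - 1) = y ^ 2 -> k = 0 \/ k = 2.
Proof.
  intros hk h.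
  assert (h2k : 0 < 2 ^ k) by (apply Z.pow_pos_nonneg; lia).
  assert (h5k : 0 < 5 ^ k) by (apply Z.pow_pos_nonneg; lia).
  assert (e10 : 10 ^ k = 2 ^ k * 5 ^ k) by (rewrite <- Z.pow_mul_l; reflexivity).
  assert (hodd : forall b, b ^ (2 * k + 1) = b * (b ^ k) ^ 2).
  { intros b. rewrite Z.pow_add_r, (Z.mul_comm 2), Z.pow_mul_r by lia. ring. }
  rewrite !hodd in h.
  (* The second factor is [2 * (5 * 10 ^ k) ^ 2 - 1], so both factors give solutions of one Pell
     equation. *)
  destruct (mul_square_gcd (2 * (2 ^ k) ^ 2 - 1) (5 * (10 * (10 ^ k) ^ 2) - 1) y)
    as (u & v & eu & ev); [nia|nia|assumption|].
  set (D := Z.gcd _ _) in *.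
  assert (hD : 0 < D).
  { pose proof (Z.gcd_nonneg (2 * (2 ^ k) ^ 2 - 1) (5 * (10 * (10 ^ k) ^ 2) - 1)) as h0.
    fold D in h0. destruct (Z.eq_dec D 0) as [e | e]; [rewrite e in eu; lia|lia]. }
  clearbody D.
  rewrite (Z.pow_even_abs u) in eu by now exists 1.
  rewrite (Z.pow_even_abs v) in ev by now exists 1.
  assert (hu : 0 < Z.abs u) by (apply Z.abs_pos; intros ->; change (Z.abs 0 ^ 2) with 0 in eu; lia).
  assert (hv : 0 < Z.abs v) by (apply Z.abs_pos; intros ->; change (Z.abs 0 ^ 2) with 0 in ev; lia).
  set (U := Z.abs u) in *. set (V := Z.abs v) in *. clearbody U V.
  destruct (pell_minimal D (2 ^ k) U) as (X1 & Y1 & hX1 & hY1 & h1 & hmin);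
    [assumption|assumption|lia|].
  destruct (pell_solution_orbit D X1 Y1 (2 ^ k) U) as (p0 & q0 & ho0 & ep0 & _);
    try assumption; [lia|].
  destruct (pell_solution_orbit D X1 Y1 (5 * 10 ^ k) V) as (p & q & ho & ep & _);
    try assumption; [nia|lia|].
  (* The odd number [p0] divides a power of 2. *)
  assert (hp0 : p0 = 1).
  { apply pell_orbit_odd in ho0. destruct ho0 as [i hi].
    assert (hr : rel_prime p0 (2 ^ k)).
    { apply rel_prime_Zpower_r; [assumption|].
      apply bezout_rel_prime, Bezout_intro with 1 (- i). lia. }
    assert (hd : (p0 | 1)) by (apply hr; [apply Z.divide_refl|now exists X1]).
    apply Z.divide_1_r in hd.
    destruct hd as [hd | hd]; [assumption|rewrite hd in ep0; lia]. }
  rewrite hp0, Z.mul_1_r in ep0. subst X1.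
  assert (hp : p = 5 ^ (k + 1)).
  { rewrite Z.pow_add_r by lia. apply (Z.mul_cancel_l _ _ (2 ^ k)); lia. }
  assert (h5p : (5 | p)) by (rewrite hp; apply Zpower_divide; lia).
  set (a := 2 * (2 ^ k) ^ 2) in *.
  (* The residue 3 would keep 5 from dividing [p]; the residue 2 makes 5 divide [4 * a - 3]. *)
  assert (ha : a mod 5 = 2).
  { destruct (square_mod5 (2 ^ k)) as [e | [e | e]].
    - exfalso. apply Z.mod_divide in e; [|lia].
      rewrite Z.pow_2_r in e. apply prime_mult in e; [|exact prime_5].
      assert (e2 : (5 | 2 ^ k)) by tauto.
      apply prime_power_prime in e2; [lia|assumption|exact prime_5|exact prime_2].
    - unfold a. rewrite Z.mul_mod, e by lia. reflexivity.
    - exfalso. apply (pell_orbit_three_mod5 a p q); try assumption.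
      unfold a. rewrite Z.mul_mod, e by lia. reflexivity. }
  assert (hN : (4 * a - 3 | 5 ^ (k + 1))).
  { rewrite <- hp. apply (pell_orbit_rank_three a p q); try assumption.
    exists (4 * (a / 5) + 1). Z.div_mod_to_equations. lia. }
  apply Zdivide_power_2 in hN; [|lia|unfold a; lia|exact prime_5].
  destruct hN as [s es].
  assert (hs : 0 <= s).
  { destruct (Z.le_gt_cases 0 s) as [h0 | h0]; [assumption|].
    rewrite Z.pow_neg_r in es by lia. unfold a in es. lia. }
  (* [4 * a - 3 = 5 ^ s] reads [2 ^ (2 * k + 3) = 5 ^ s + 3]. *)
  assert (hle : 2 * k + 3 <= 7).
  { apply (pow2_eq_pow5_add_3 _ s); [lia|assumption|].
    replace (2 * k + 3) with (k * 2 + 3) by ring.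
    rewrite Z.pow_add_r, Z.pow_mul_r by lia. unfold a in es. lia. }
  assert (hk3 : k = 0 \/ k = 1 \/ k = 2) by lia.
  (* For [k = 1], [a = 8] is 3 modulo 5. *)
  destruct hk3 as [-> | [-> | ->]]; [now left|discriminate ha|now right].
Qed.

Theorem theorem27 (n x : Z) (hn : 2 <= n) (hx : 0 < x) :
  (2 ^ n - 2) * (10 ^ n - 2) = x ^ 2 <-> (n, x) = (2, 14) \/ (n, x) = (6, 7874).
Proof.
  split; [|intros [h | h]; injection h as -> ->; reflexivity].
  intros h.
  assert (e2 : 2 ^ n = 2 * 2 ^ (n - 1)).
  { rewrite <- Z.pow_succ_r by lia. f_equal. lia. }
  assert (e10 : 10 ^ n = 10 * 10 ^ (n - 1)).
  { rewrite <- Z.pow_succ_r by lia. f_equal. lia. }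
  assert (hy : exists y, x = 2 * y).
  { destruct (Z.Even_or_Odd x) as [hy | [i hi]]; [assumption|exfalso].
    rewrite e2, hi in h. lia. }
  destruct hy as [y ->].
  assert (hm : (2 ^ (n - 1) - 1) * (5 * 10 ^ (n - 1) - 1) = y ^ 2)
    by (rewrite e2, e10 in h; lia).
  destruct (Z.Even_or_Odd (n - 1)) as [[j hj] | [k hk]].
  - exfalso. rewrite hj in hm. apply (no_even_solution j y); [lia|].
    rewrite <- hm. f_equal. rewrite Z.pow_mul_r by lia. reflexivity.
  - rewrite hk in hm. destruct (odd_solution k y) as [-> | ->]; [lia|assumption| |].
    (* Here [y ^ 2 = 49]; in the other case [y ^ 2 = 31 * 499999 = 3937 ^ 2]. *)
    + left. replace n with 2 in * by lia. f_equal. cbn in hm. nia.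
    + right. replace n with 6 in * by lia. f_equal. cbn in hm. nia.
Qed.
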